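(* Let $A$ be an associative unital algebra over a field $\Bbbk$. The dualizing functors $(\cdot)^*\colon{}_A\mathcal{M}_A\to({}_A\mathcal{M}_A)^{\mathrm{op}}$ and ${}^*(\cdot)\colon({}_A\mathcal{M}_A)^{\mathrm{op}}\to{}_A\mathcal{M}_A$ (with $(\cdot)^*$ left adjoint to ${}^*(\cdot)$) induce an adjunction between the category $\underline{\mathrm{FODC}}_A$ of first order differential calculi on $A$ and the opposite category $(\underline{\mathrm{FOVC}}_A)^{\mathrm{op}}$ of first order vector field calculi on $A$, with $(\cdot)^*\colon\underline{\mathrm{FODC}}_A\to(\underline{\mathrm{FOVC}}_A)^{\mathrm{op}}$ left adjoint to ${}^*(\cdot)\colon(\underline{\mathrm{FOVC}}_A)^{\mathrm{op}}\to\underline{\mathrm{FODC}}_A$. These functors are compatible with the forgetful functors $\mathrm{forget}_{\mathrm{d}}\colon\underline{\mathrm{FODC}}_A\to{}_A\mathcal{M}_A$, $(\Gamma,\mathrm{d})\mapsto\Gamma$, and $(\mathrm{forget}_{\mathscr{L}})^{\mathrm{op}}\colon(\underline{\mathrm{FOVC}}_A)^{\mathrm{op}}\to({}_A\mathcal{M}_A)^{\mathrm{op}}$, $(\mathfrak{X},\mathscr{L})\mapsto\mathfrak{X}$, i.e. the adjunction lies over the adjunction between ${}_A\mathcal{M}_A$ and $({}_A\mathcal{M}_A)^{\mathrm{op}}$.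
   Context: A first order vector field calculus (FOVC) on $A$ is a pair $(\mathfrak{X},\mathscr{L})$ where $\mathfrak{X}$ is an $A$-bimodule and $\mathscr{L}\colon\mathfrak{X}\to\mathrm{End}_\Bbbk(A)$ is $\Bbbk$-linear, injective, left $A$-linear ($\mathscr{L}_{a\cdot X}(b)=a\mathscr{L}_X(b)$) and satisfies $\mathscr{L}_X(ab)=\mathscr{L}_X(a)b+\mathscr{L}_{X\cdot a}(b)$. A morphism of FOVCi is an $A$-bimodule map $\Phi\colon\mathfrak{X}\to\mathfrak{X}'$ with $\mathscr{L}'\circ\Phi=\mathscr{L}$. A first order differential calculus (FODC) on $A$ is a pair $(\Gamma,\mathrm{d})$ where $\Gamma$ is an $A$-bimodule, $\mathrm{d}\colon A\to\Gamma$ is $\Bbbk$-linear with $\mathrm{d}(ab)=\mathrm{d}(a)b+a\,\mathrm{d}(b)$, and $A\otimes A\to\Gamma$, $a\otimes b\mapsto a\,\mathrm{d}(b)$ is surjective. A morphism $(\Gamma,\mathrm{d})\to(\Gamma',\mathrm{d}')$ is an $A$-bimodule map $\Psi$ with $\mathrm{d}'=\Psi\circ\mathrm{d}$. ${}_A\mathcal{M}_A$ is the category of $A$-bimodules. On objects $M^*:=\mathrm{Hom}_A(M,A)$ (right $A$-linear maps) with bimodule structure $(a\cdot\phi\cdot b)(m)=a\,\phi(b\cdot m)$, and ${}^*M:={}_A\mathrm{Hom}(M,A)$ (left $A$-linear maps) with $(a\cdot\psi\cdot b)(m)=\psi(m\cdot a)\,b$; on morphisms both functors act by precomposition. On calculi,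 $(\cdot)^*$ sends $(\Gamma,\mathrm{d})$ to $(\mathrm{Hom}_A(\Gamma,A),\mathscr{L})$ with $\mathscr{L}_X(a):=X(\mathrm{d}a)$, and ${}^*(\cdot)$ sends $(\mathfrak{X},\mathscr{L})$ to $({}_A\mathrm{Hom}(\mathfrak{X},A),\mathrm{d})$ with $(\mathrm{d}a)(X):=\mathscr{L}_X(a)$. The unit and counit of the adjunction on bimodules are given by the evaluation maps $M\to{}^*(M^* )$, $m\mapsto(\phi\mapsto\phi(m))$, and $M\to({}^*M)^*$, $m\mapsto(\psi\mapsto\psi(m))$ (the latter viewed as a morphism $({}^*M)^*\to M$ in the opposite category).
   Formalization: As AHom(X,A) need not be generated by A dA (A=k[x], X=A, L_f(g)=f x g'), *(X,L) is taken to be (A dA, d), A dA inside AHom(X,A); *( ) and the unit and counit lie over those on bimodules via the natural injection A dA -> AHom(X,A), an iso when (AHom(X,A),d) is a FODC. *)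

(* Defs.v *)
From HB Require Import structures.
From mathcomp Require Import all_boot all_algebra.
From mathcomp Require Import boolp functions.

Set Implicit Arguments.
Unset Strict Implicit.
Unset Printing Implicit Defensive.

Import GRing.Theory.
Local Open Scope ring_scope.

Declare Scope cat_scope.
Delimit Scope cat_scope with cat.

Record category := Category {
  ob :> Type;
  hom : ob -> ob -> Type;
  idm : forall X, hom X X;
  comp : forall X Y Z, hom Y Z -> hom X Y -> hom X Z;
  comp1m : forall X Y (f : hom X Y), comp (idm Y) f = f;
  compm1 : forall X Y (f : hom X Y), comp f (idm X) = f;
  compmA : forall X Y Z T (f : hom Z T) (g : hom Y Z) (h : hom X Y),
    comp f (comp g h) = comp (comp f g) h }.
Arguments hom {c} X Y.
Arguments idm {c} X.
Arguments comp {c X Y Z} g f.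
Notation "g '\oc' f" := (comp g f) (at level 50, left associativity) : cat_scope.

Definition opc (C : category) : category :=
  @Category C (fun X Y => @hom C Y X) (@idm C) (fun X Y Z g f => comp f g)
    (fun X Y f => compm1 f) (fun X Y f => comp1m f)
    (fun X Y Z T f g h => esym (compmA h g f)).

Record functor (C D : category) := Functor {
  fob :> C -> D;
  fmap : forall X Y, hom X Y -> hom (fob X) (fob Y);
  fmap1 : forall X, fmap (idm X) = idm (fob X);
  fmapM : forall X Y Z (g : hom Y Z) (f : hom X Y),
    fmap (comp g f) = comp (fmap g) (fmap f) }.
Arguments fmap {C D} _ {X Y} _.

Definition idF (C : category) : functor C C :=
  @Functor C C id (fun _ _ => id) (fun _ => erefl) (fun _ _ _ _ _ => erefl).

Section FunctorOps.
Variables C D E : category.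

Fact compF1 (G : functor D E) (F : functor C D) X :
  fmap G (fmap F (idm X)) = idm (G (F X)).
Proof. by rewrite !fmap1. Qed.

Fact compFM (G : functor D E) (F : functor C D) X Y Z
    (g : hom Y Z) (f : hom X Y) :
  fmap G (fmap F (comp g f)) = comp (fmap G (fmap F g)) (fmap G (fmap F f)).
Proof. by rewrite !fmapM. Qed.

Definition compF (G : functor D E) (F : functor C D) : functor C E :=
  @Functor C E (fun X => G (F X)) (fun X Y f => fmap G (fmap F f))
    (compF1 G F) (compFM G F).

Definition opF (F : functor C D) : functor (opc C) (opc D) :=
  @Functor (opc C) (opc D) F (fun X Y f => @fmap C D F Y X f)
    (fmap1 F) (fun X Y Z g f => @fmapM C D F Z Y X f g).
End FunctorOps.
Notation "G '\oF' F" := (compF G F) (at level 50, left associativity) : cat_scope.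

Record nat_trans (C D : category) (F G : functor C D) := NatTrans {
  nt :> forall X, hom (F X) (G X);
  ntP : forall X Y (f : hom X Y), comp (fmap G f) (nt X) = comp (nt Y) (fmap F f) }.

Definition is_iso (C : category) (X Y : C) (f : hom X Y) : Prop :=
  exists2 g : hom Y X, comp g f = idm X & comp f g = idm Y.

(* [is_adjunction eta eps]: F is left adjoint to G, with unit eta and counit
   eps. *)
Definition is_adjunction (C D : category) (F : functor C D) (G : functor D C)
    (eta : nat_trans (idF C) (compF G F)) (eps : nat_trans (compF F G) (idF D)) :
    Prop :=
  (forall X, comp (eps (F X)) (fmap F (eta X)) = idm (F X)) /\
  (forall Y, comp (fmap G (eps Y)) (eta (G Y)) = idm (G Y)).

(* The left and the right k-action on a bimodule coincide; both are induced by
   the A-actions. *)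
HB.mixin Record Lmodule_isBimodule (k : fieldType) (A : algType k) M
    of GRing.Lmodule A M := {
  ract : M -> A -> M;
  ractDl : forall x y a, ract (x + y) a = ract x a + ract y a;
  ractDr : forall x a b, ract x (a + b) = ract x a + ract x b;
  ract1 : forall x, ract x 1 = x;
  ractM : forall x a b, ract x (a * b) = ract (ract x a) b;
  ractZ : forall a x b, ract (a *: x) b = a *: ract x b;
  ractk : forall (c : k) x, ract x c%:A = c%:A *: x }.

#[short(type="bimodType")]
HB.structure Definition Bimodule (k : fieldType) (A : algType k) :=
  { M of GRing.Lmodule A M & Lmodule_isBimodule k A M }.

Section BimoduleTheory.
Variables (k : fieldType) (A : algType k).
Implicit Types M N P : bimodType A.

Lemma ract0 M a : ract (0 : M) a = 0.
Proof. by apply: (addrI (ract (0 : M) a)); rewrite -ractDl !addr0. Qed.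

Lemma ract_sum M I (s : seq I) (F : I -> M) a :
  ract (\sum_(i <- s) F i) a = \sum_(i <- s) ract (F i) a.
Proof. by apply: (big_morph (fun x : M => ract x a)) => [x y|]; rewrite ?ractDl ?ract0. Qed.

Record bimodHom M N := BimodHom {
  bimodHom_fun :> M -> N;
  bimodHom_lin : linear bimodHom_fun;
  bimodHom_ract : forall x a, bimodHom_fun (ract x a) = ract (bimodHom_fun x) a }.

Lemma bimodHom_eq M N (f g : bimodHom M N) : f =1 g -> f = g.
Proof.
case: f g => [f fl fr] [g gl gr] /= /funext E.
by case: _ / E in gl gr *; congr BimodHom; apply: Prop_irrelevance.
Qed.

Definition bimod_id M : bimodHom M M :=
  @BimodHom M M id (fun _ _ _ => erefl) (fun _ _ => erefl).

Fact bimod_comp_lin M N P (g : bimodHom N P) (f : bimodHom M N) :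
  linear (fun x => g (f x)).
Proof. by move=> a x y; rewrite !bimodHom_lin. Qed.

Fact bimod_comp_ract M N P (g : bimodHom N P) (f : bimodHom M N) x a :
  g (f (ract x a)) = ract (g (f x)) a.
Proof. by rewrite !bimodHom_ract. Qed.

Definition bimod_comp M N P (g : bimodHom N P) (f : bimodHom M N) :
  bimodHom M P := BimodHom (bimod_comp_lin g f) (bimod_comp_ract g f).

Fact bimod_comp1m M N (f : bimodHom M N) : bimod_comp (bimod_id N) f = f.
Proof. exact: bimodHom_eq. Qed.

Fact bimod_compm1 M N (f : bimodHom M N) : bimod_comp f (bimod_id M) = f.
Proof. exact: bimodHom_eq. Qed.

Fact bimod_compA M N P Q (f : bimodHom P Q) (g : bimodHom N P)
    (h : bimodHom M N) :
  bimod_comp f (bimod_comp g h) = bimod_comp (bimod_comp f g) h.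
Proof. exact: bimodHom_eq. Qed.

Lemma bimodHomD M N (f : bimodHom M N) x y : f (x + y) = f x + f y.
Proof. by have := bimodHom_lin f 1 x y; rewrite !scale1r. Qed.

Lemma bimodHomZ M N (f : bimodHom M N) a x : f (a *: x) = a *: f x.
Proof.
have f0 : f 0 = 0 by apply: (addrI (f 0)); rewrite -bimodHomD !addr0.
by have := bimodHom_lin f a x 0; rewrite !addr0 f0 addr0.
Qed.

End BimoduleTheory.

Definition bimodC (k : fieldType) (A : algType k) : category :=
  @Category (bimodType A) (@bimodHom k A) (@bimod_id k A) (@bimod_comp k A)
    (@bimod_comp1m k A) (@bimod_compm1 k A) (@bimod_compA k A).

Section RightDual.
Variables (k : fieldType) (A : algType k) (M : bimodType A).

Definition right_linear (f : M -> A) : Prop :=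
  {morph f : x y / x + y} /\ (forall x a, f (ract x a) = f x * a).
Definition right_linearb : {pred M -> A} := fun f => `[< right_linear f >].

Record rdual := RDual { rdual_fun :> M -> A; _ : rdual_fun \in right_linearb }.
HB.instance Definition _ := [isSub for rdual_fun].
HB.instance Definition _ := [Choice of rdual by <:].

Fact right_linear_zmod_closed : zmod_closed right_linearb.
Proof.
split=> [|f g /asboolP[fD fM] /asboolP[gD gM]]; apply/asboolP.
  by split=> [x y|x a]; rewrite ?addr0 ?mul0r.
split=> [x y|x a]; first by rewrite !fctE fD gD opprD addrACA.
by rewrite !fctE fM gM mulrBl.
Qed.
HB.instance Definition _ :=
  GRing.isZmodClosed.Build (M -> A) right_linearb right_linear_zmod_closed.
HB.instance Definition _ := [SubChoice_isSubZmodule of rdual by <:].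

Lemma rdualP (f : rdual) : right_linear f.
Proof. by case: f => f /= /asboolP. Qed.

Definition mk_rdual (f : M -> A) (fP : right_linear f) : rdual :=
  RDual (introT (asboolP _) fP).

Lemma rdual_eq (f g : rdual) : f =1 g -> f = g.
Proof. by move=> /funext E; apply: val_inj. Qed.

Lemma rdualD (f g : rdual) x : (f + g) x = f x + g x.
Proof. by []. Qed.

Fact rdual_lact_subproof (a : A) (f : rdual) : right_linear (fun m => a * f m).
Proof.
have [fD fM] := rdualP f.
by split=> [x y|x b]; rewrite ?fD ?mulrDr ?fM ?mulrA.
Qed.
Definition rdual_lact a f := mk_rdual (rdual_lact_subproof a f).

Fact rdual_ract_subproof (f : rdual) (b : A) : right_linear (fun m => f (b *: m)).
Proof.
have [fD fM] := rdualP f.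
by split=> [x y|x c]; rewrite ?scalerDr ?fD // -ractZ fM.
Qed.
Definition rdual_ract f b := mk_rdual (rdual_ract_subproof f b).

Fact rdual_lactA a b f : rdual_lact a (rdual_lact b f) = rdual_lact (a * b) f.
Proof. by apply: rdual_eq => x /=; rewrite mulrA. Qed.
Fact rdual_lact1 : left_id 1 rdual_lact.
Proof. by move=> f; apply: rdual_eq => x /=; rewrite mul1r. Qed.
Fact rdual_lactDr : right_distributive rdual_lact +%R.
Proof. by move=> a f g; apply: rdual_eq => x /=; rewrite ?rdualD mulrDr. Qed.
Fact rdual_lactDl f : {morph rdual_lact^~ f : a b / a + b}.
Proof. by move=> a b; apply: rdual_eq => x; rewrite /= mulrDl. Qed.
HB.instance Definition _ := GRing.Zmodule_isLmodule.Build A rdual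
  rdual_lactA rdual_lact1 rdual_lactDr rdual_lactDl.

Fact rdual_ractDl (f g : rdual) a :
  rdual_ract (f + g) a = rdual_ract f a + rdual_ract g a.
Proof. by apply: rdual_eq => x. Qed.
Fact rdual_ractDr (f : rdual) a b :
  rdual_ract f (a + b) = rdual_ract f a + rdual_ract f b.
Proof.
by apply: rdual_eq => x; rewrite ?rdualD /= scalerDl; case: (rdualP f) => ->.
Qed.
Fact rdual_ract1 (f : rdual) : rdual_ract f 1 = f.
Proof. by apply: rdual_eq => x /=; rewrite scale1r. Qed.
Fact rdual_ractM (f : rdual) a b :
  rdual_ract f (a * b) = rdual_ract (rdual_ract f a) b.
Proof. by apply: rdual_eq => x /=; rewrite scalerA. Qed.
Fact rdual_ractZ a (f : rdual) b : rdual_ract (a *: f) b = a *: rdual_ract f b.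
Proof. by apply: rdual_eq. Qed.
Fact rdual_ractk (c : k) (f : rdual) : rdual_ract f c%:A = c%:A *: f.
Proof.
apply: rdual_eq => x /=; rewrite -ractk; case: (rdualP f) => _ ->.
by rewrite mulr_algr mulr_algl.
Qed.
HB.instance Definition _ := Lmodule_isBimodule.Build k A rdual
  rdual_ractDl rdual_ractDr rdual_ract1 rdual_ractM rdual_ractZ rdual_ractk.

End RightDual.

Section LeftDual.
Variables (k : fieldType) (A : algType k) (M : bimodType A).

Definition left_linearb : {pred M -> A} := fun f => `[< scalar f >].

Record ldual := LDual { ldual_fun :> M -> A; _ : ldual_fun \in left_linearb }.
HB.instance Definition _ := [isSub for ldual_fun].
HB.instance Definition _ := [Choice of ldual by <:].

Fact left_linear_zmod_closed : zmod_closed left_linearb.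
Proof.
split=> [|f g /asboolP fP /asboolP gP]; apply/asboolP => a x y.
  by rewrite mulr0 addr0.
by rewrite !fctE fP gP opprD addrACA mulrBr.
Qed.
HB.instance Definition _ :=
  GRing.isZmodClosed.Build (M -> A) left_linearb left_linear_zmod_closed.
HB.instance Definition _ := [SubChoice_isSubZmodule of ldual by <:].

Lemma ldualP (f : ldual) : scalar f.
Proof. by case: f => f /= /asboolP. Qed.

Definition mk_ldual (f : M -> A) (fP : scalar f) : ldual :=
  LDual (introT (asboolP _) fP).

Lemma ldual_eq (f g : ldual) : f =1 g -> f = g.
Proof. by move=> /funext E; apply: val_inj. Qed.

Lemma ldualD (f g : ldual) x : (f + g) x = f x + g x.
Proof. by []. Qed.

Lemma ldual_funD (f : ldual) x y : f (x + y) = f x + f y.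
Proof. by have := ldualP f 1 x y; rewrite scale1r mul1r. Qed.

Lemma ldual_funZ (f : ldual) a x : f (a *: x) = a * f x.
Proof.
have f0 : f 0 = 0 by apply: (addrI (f 0)); rewrite -ldual_funD !addr0.
by have := ldualP f a x 0; rewrite !addr0 f0 addr0.
Qed.

Fact ldual_lact_subproof (a : A) (f : ldual) : scalar (fun m : M => f (ract m a)).
Proof. by move=> b x y; rewrite ractDl ractZ ldualP. Qed.
Definition ldual_lact a f := mk_ldual (ldual_lact_subproof a f).

Fact ldual_ract_subproof (f : ldual) (b : A) : scalar (fun m : M => f m * b).
Proof. by move=> a x y; rewrite ldualP mulrDl mulrA. Qed.
Definition ldual_ract f b := mk_ldual (ldual_ract_subproof f b).

Fact ldual_lactA a b f : ldual_lact a (ldual_lact b f) = ldual_lact (a * b) f.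
Proof. by apply: ldual_eq => x /=; rewrite ractM. Qed.
Fact ldual_lact1 : left_id 1 ldual_lact.
Proof. by move=> f; apply: ldual_eq => x /=; rewrite ract1. Qed.
Fact ldual_lactDr : right_distributive ldual_lact +%R.
Proof. by move=> a f g; apply: ldual_eq => x. Qed.
Fact ldual_lactDl f : {morph ldual_lact^~ f : a b / a + b}.
Proof. by move=> a b; apply: ldual_eq => x; rewrite /= ractDr ldual_funD. Qed.
HB.instance Definition _ := GRing.Zmodule_isLmodule.Build A ldual
  ldual_lactA ldual_lact1 ldual_lactDr ldual_lactDl.

Fact ldual_ractDl (f g : ldual) a :
  ldual_ract (f + g) a = ldual_ract f a + ldual_ract g a.
Proof. by apply: ldual_eq => x /=; rewrite ?ldualD mulrDl. Qed.
Fact ldual_ractDr (f : ldual) a b :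
  ldual_ract f (a + b) = ldual_ract f a + ldual_ract f b.
Proof. by apply: ldual_eq => x; rewrite ?ldualD /= mulrDr. Qed.
Fact ldual_ract1 (f : ldual) : ldual_ract f 1 = f.
Proof. by apply: ldual_eq => x /=; rewrite mulr1. Qed.
Fact ldual_ractM (f : ldual) a b :
  ldual_ract f (a * b) = ldual_ract (ldual_ract f a) b.
Proof. by apply: ldual_eq => x /=; rewrite mulrA. Qed.
Fact ldual_ractZ a (f : ldual) b : ldual_ract (a *: f) b = a *: ldual_ract f b.
Proof. by apply: ldual_eq. Qed.
Fact ldual_ractk (c : k) (f : ldual) : ldual_ract f c%:A = c%:A *: f.
Proof.
by apply: ldual_eq => x /=; rewrite ractk ldual_funZ mulr_algr mulr_algl.
Qed.
Lemma ldualZ a (f : ldual) x : (a *: f) x = f (ract x a).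
Proof. by []. Qed.

HB.instance Definition _ := Lmodule_isBimodule.Build k A ldual
  ldual_ractDl ldual_ractDr ldual_ract1 ldual_ractM ldual_ractZ ldual_ractk.

End LeftDual.

Section DualMaps.
Variables (k : fieldType) (A : algType k).
Implicit Types M N : bimodType A.

Fact rdual_map_subproof M N (f : bimodHom M N) (phi : rdual N) :
  right_linear (fun m => phi (f m)).
Proof.
have [pD pM] := rdualP phi.
by split=> [x y|x a]; rewrite ?bimodHomD ?pD // bimodHom_ract pM.
Qed.
Definition rdual_map_fun M N (f : bimodHom M N) (phi : rdual N) : rdual M :=
  mk_rdual (rdual_map_subproof f phi).
Fact rdual_map_lin M N (f : bimodHom M N) : linear (rdual_map_fun f).
Proof. by move=> a x y; apply: rdual_eq. Qed.
Fact rdual_map_ract M N (f : bimodHom M N) x a :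
  rdual_map_fun f (ract x a) = ract (rdual_map_fun f x) a.
Proof. by apply: rdual_eq => m /=; rewrite bimodHomZ. Qed.
Definition rdual_map M N (f : bimodHom M N) : bimodHom (rdual N) (rdual M) :=
  BimodHom (rdual_map_lin f) (rdual_map_ract f).

Fact ldual_map_subproof M N (f : bimodHom M N) (psi : ldual N) :
  scalar (fun m : M => psi (f m)).
Proof. by move=> a x y; rewrite bimodHomD bimodHomZ ldualP. Qed.
Definition ldual_map_fun M N (f : bimodHom M N) (psi : ldual N) : ldual M :=
  mk_ldual (ldual_map_subproof f psi).
Fact ldual_map_lin M N (f : bimodHom M N) : linear (ldual_map_fun f).
Proof.
by move=> a x y; apply: ldual_eq => m; rewrite ldualD ldualZ /= bimodHom_ract.
Qed.
Fact ldual_map_ract M N (f : bimodHom M N) x a :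
  ldual_map_fun f (ract x a) = ract (ldual_map_fun f x) a.
Proof. by apply: ldual_eq. Qed.
Definition ldual_map M N (f : bimodHom M N) : bimodHom (ldual N) (ldual M) :=
  BimodHom (ldual_map_lin f) (ldual_map_ract f).

Fact rdual_map1 M : rdual_map (bimod_id M) = bimod_id (rdual M).
Proof. by apply: bimodHom_eq => x; apply: rdual_eq. Qed.
Fact rdual_mapM M N P (g : bimodHom N P) (f : bimodHom M N) :
  rdual_map (bimod_comp g f) = bimod_comp (rdual_map f) (rdual_map g).
Proof. by apply: bimodHom_eq => x; apply: rdual_eq. Qed.
Fact ldual_map1 M : ldual_map (bimod_id M) = bimod_id (ldual M).
Proof. by apply: bimodHom_eq => x; apply: ldual_eq. Qed.
Fact ldual_mapM M N P (g : bimodHom N P) (f : bimodHom M N) :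
  ldual_map (bimod_comp g f) = bimod_comp (ldual_map f) (ldual_map g).
Proof. by apply: bimodHom_eq => x; apply: ldual_eq. Qed.

End DualMaps.

Definition rdualF (k : fieldType) (A : algType k) :
    functor (bimodC A) (opc (bimodC A)) :=
  @Functor (bimodC A) (opc (bimodC A)) (fun M => rdual M)
    (@rdual_map k A) (@rdual_map1 k A)
    (fun M N P g f => rdual_mapM g f).

Definition ldualF (k : fieldType) (A : algType k) :
    functor (opc (bimodC A)) (bimodC A) :=
  @Functor (opc (bimodC A)) (bimodC A) (fun M => ldual M)
    (fun M N f => @ldual_map k A N M f) (@ldual_map1 k A)
    (fun M N P g f => ldual_mapM f g).

Section Calculi.
Variables (k : fieldType) (A : algType k).
Implicit Types M N : bimodType A.

Definition klinear M (f : A -> M) : Prop :=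
  forall (c : k) a b, f (c *: a + b) = c%:A *: f a + f b.

Record derivation M := Derivation {
  der_fun :> A -> M;
  derL : klinear der_fun;
  derM : forall a b, der_fun (a * b) = ract (der_fun a) b + a *: der_fun b }.

(* w is the image of the tensor \sum_(p <- s) p.1 (x) p.2 under
   a (x) b |-> a d(b). *)
Definition in_AdA M (d : A -> M) (w : M) : Prop :=
  exists s : seq (A * A), w = \sum_(p <- s) p.1 *: d p.2.

Record fodc := Fodc {
  fodc_mod :> bimodType A;
  fodc_d : derivation fodc_mod;
  fodc_gen : forall w, in_AdA fodc_d w }.

Record fodcHom (G H : fodc) := FodcHom {
  fodcHom_map :> bimodHom G H;
  fodcHomP : forall a, fodc_d H a = fodcHom_map (fodc_d G a) }.

Record fovc := Fovc {
  fovc_mod :> bimodType A;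
  lie : fovc_mod -> A -> A;
  lie_end : forall X, linear (lie X);
  lie_lin : forall (c : k) X Y a, lie (c%:A *: X + Y) a = c *: lie X a + lie Y a;
  lie_inj : injective lie;
  lie_lact : forall a X b, lie (a *: X) b = a * lie X b;
  lieM : forall X a b, lie X (a * b) = lie X a * b + lie (ract X a) b }.

Record fovcHom (X Y : fovc) := FovcHom {
  fovcHom_map :> bimodHom X Y;
  fovcHomP : forall x, lie (fovcHom_map x) = lie x }.

Lemma fodcHom_eq G H (f g : fodcHom G H) : f =1 g -> f = g.
Proof.
case: f g => [f fP] [g gP] /= /bimodHom_eq E.
by case: _ / E in gP *; congr FodcHom; apply: Prop_irrelevance.
Qed.

Lemma fovcHom_eq X Y (f g : fovcHom X Y) : f =1 g -> f = g.
Proof.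
case: f g => [f fP] [g gP] /= /bimodHom_eq E.
by case: _ / E in gP *; congr FovcHom; apply: Prop_irrelevance.
Qed.

Definition fodc_id (G : fodc) : fodcHom G G :=
  @FodcHom G G (bimod_id G) (fun=> erefl).
Fact fodc_comp_subproof G H K (g : fodcHom H K) (f : fodcHom G H) a :
  fodc_d K a = bimod_comp g f (fodc_d G a).
Proof. by rewrite (fodcHomP g) (fodcHomP f). Qed.
Definition fodc_comp G H K (g : fodcHom H K) (f : fodcHom G H) : fodcHom G K :=
  FodcHom (fodc_comp_subproof g f).

Definition fovc_id (X : fovc) : fovcHom X X :=
  @FovcHom X X (bimod_id X) (fun=> erefl).
Fact fovc_comp_subproof X Y Z (g : fovcHom Y Z) (f : fovcHom X Y) x :
  lie (bimod_comp g f x) = lie x.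
Proof. by rewrite /= (fovcHomP g) (fovcHomP f). Qed.
Definition fovc_comp X Y Z (g : fovcHom Y Z) (f : fovcHom X Y) : fovcHom X Z :=
  FovcHom (fovc_comp_subproof g f).

Fact fodc_comp1m G H (f : fodcHom G H) : fodc_comp (fodc_id H) f = f.
Proof. exact: fodcHom_eq. Qed.
Fact fodc_compm1 G H (f : fodcHom G H) : fodc_comp f (fodc_id G) = f.
Proof. exact: fodcHom_eq. Qed.
Fact fodc_compA G H K L (f : fodcHom K L) (g : fodcHom H K) (h : fodcHom G H) :
  fodc_comp f (fodc_comp g h) = fodc_comp (fodc_comp f g) h.
Proof. exact: fodcHom_eq. Qed.
Fact fovc_comp1m X Y (f : fovcHom X Y) : fovc_comp (fovc_id Y) f = f.
Proof. exact: fovcHom_eq. Qed.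
Fact fovc_compm1 X Y (f : fovcHom X Y) : fovc_comp f (fovc_id X) = f.
Proof. exact: fovcHom_eq. Qed.
Fact fovc_compA X Y Z T (f : fovcHom Z T) (g : fovcHom Y Z) (h : fovcHom X Y) :
  fovc_comp f (fovc_comp g h) = fovc_comp (fovc_comp f g) h.
Proof. exact: fovcHom_eq. Qed.

Definition fodcC : category :=
  Category fodc_comp1m fodc_compm1 fodc_compA.
Definition fovcC : category :=
  Category fovc_comp1m fovc_compm1 fovc_compA.

Definition forget_d : functor fodcC (bimodC A) :=
  @Functor fodcC (bimodC A) fodc_mod (fun _ _ f => fodcHom_map f)
    (fun=> erefl) (fun _ _ _ _ _ => erefl).
Definition forget_lie : functor fovcC (bimodC A) :=
  @Functor fovcC (bimodC A) fovc_mod (fun _ _ f => fovcHom_map f)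
    (fun=> erefl) (fun _ _ _ _ _ => erefl).

Section RightDualCalculus.
Variable G : fodc.
Notation d := (fodc_d G).

Definition rdual_lie (X : rdual G) (a : A) : A := X (d a).

Lemma rdual_funZr (X : rdual G) (c : k) w : X (c%:A *: w) = c *: X w.
Proof. by rewrite -ractk; case: (rdualP X) => _ ->; rewrite mulr_algr. Qed.

Fact rdual_lie_end X : linear (rdual_lie X).
Proof.
by move=> c a b; rewrite /rdual_lie derL; case: (rdualP X) => -> _; rewrite rdual_funZr.
Qed.
Fact rdual_lie_lin (c : k) X Y a :
  rdual_lie (c%:A *: X + Y) a = c *: rdual_lie X a + rdual_lie Y a.
Proof. by rewrite /rdual_lie rdualD /= mulr_algl. Qed.
Fact rdual_lieM X a b :
  rdual_lie X (a * b) = rdual_lie X a * b + rdual_lie (ract X a) b.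
Proof. by rewrite /rdual_lie derM; case: (rdualP X) => -> ->. Qed.
Fact rdual_lie_inj : injective rdual_lie.
Proof.
move=> X Y E; apply: rdual_eq => w; have [s ->] := fodc_gen w.
have [XD XM] := rdualP X; have [YD YM] := rdualP Y.
have Zd Z a b : right_linear (rdual_fun Z) ->
    Z (a *: d b) = rdual_lie Z (a * b) - rdual_lie Z a * b.
  by case=> ZD ZM; rewrite /rdual_lie derM ZD ZM addrC addKr.
have Z0 Z : right_linear (rdual_fun Z) -> (Z : rdual G) 0 = 0.
  by case=> ZD _; apply: (addrI (Z 0)); rewrite -ZD !addr0.
elim: s => [|p s IH]; first by rewrite big_nil !Z0.
by rewrite big_cons XD YD IH !Zd // E.
Qed.

Definition fodc_dual : fovc :=
  @Fovc (rdual G) rdual_lie rdual_lie_end rdual_lie_lin rdual_lie_inj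
    (fun _ _ _ => erefl) rdual_lieM.
End RightDualCalculus.

Fact fodc_dual_map_subproof G H (f : fodcHom G H) (X : fodc_dual H) :
  lie (rdual_map f X : fodc_dual G) = lie X.
Proof. by apply/funext => a; rewrite /= /rdual_lie /= -fodcHomP. Qed.
Definition fodc_dual_map G H (f : fodcHom G H) :
    fovcHom (fodc_dual H) (fodc_dual G) :=
  @FovcHom (fodc_dual H) (fodc_dual G) (rdual_map f) (fodc_dual_map_subproof f).
Fact fodc_dual_map1 G : fodc_dual_map (fodc_id G) = fovc_id (fodc_dual G).
Proof. by apply: fovcHom_eq => x; apply: rdual_eq. Qed.
Fact fodc_dual_mapM G H K (g : fodcHom H K) (f : fodcHom G H) :
  fodc_dual_map (fodc_comp g f) = fovc_comp (fodc_dual_map f) (fodc_dual_map g).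
Proof. by apply: fovcHom_eq => x; apply: rdual_eq. Qed.

Definition fodc_dualF : functor fodcC (opc fovcC) :=
  @Functor fodcC (opc fovcC) fodc_dual fodc_dual_map fodc_dual_map1
    fodc_dual_mapM.

(* The sub-bimodule A dA of M; it is stable on the right since
   d(b) c = d(b c) - b d(c). *)
Section Generated.
Variables (M : bimodType A) (d : derivation M).

Definition AdAb : {pred M} := fun w => `[< in_AdA d w >].
Record AdA := MkAdA { AdA_val :> M; _ : AdA_val \in AdAb }.
HB.instance Definition _ := [isSub for AdA_val].
HB.instance Definition _ := [Choice of AdA by <:].

Fact AdA_submod_closed : submod_closed AdAb.
Proof.
split=> [|a x y /asboolP[s ->] /asboolP[t ->]]; apply/asboolP.
  by exists [::]; rewrite big_nil.
exists ([seq (a * p.1, p.2) | p <- s] ++ t).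
rewrite big_cat big_map scaler_sumr; congr (_ + _).
by apply: eq_bigr => p _; rewrite scalerA.
Qed.
HB.instance Definition _ :=
  GRing.isSubmodClosed.Build A M AdAb AdA_submod_closed.
HB.instance Definition _ := [SubChoice_isSubLmodule of AdA by <:].

Lemma AdAP (w : AdA) : in_AdA d w.
Proof. by case: w => w /= /asboolP. Qed.
Definition mk_AdA (w : M) (wP : in_AdA d w) : AdA := MkAdA (introT (asboolP _) wP).

Fact AdA_ract_subproof (w : AdA) (c : A) : in_AdA d (ract (w : M) c).
Proof.
have [s ->] := AdAP w; rewrite ract_sum.
exists (flatten [seq [:: (p.1, p.2 * c); (- (p.1 * p.2), c)] | p <- s]).
rewrite big_flatten big_map; apply: eq_bigr => p _.
rewrite big_cons big_seq1 /= derM ractZ scalerDr scaleNr.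
by rewrite scalerA addrK.
Qed.
Definition AdA_ract w c := mk_AdA (AdA_ract_subproof w c).

Fact AdA_ractDl x y a : AdA_ract (x + y) a = AdA_ract x a + AdA_ract y a.
Proof. by apply: val_inj; rewrite /= ractDl. Qed.
Fact AdA_ractDr x a b : AdA_ract x (a + b) = AdA_ract x a + AdA_ract x b.
Proof. by apply: val_inj; rewrite /= ractDr. Qed.
Fact AdA_ract1 x : AdA_ract x 1 = x.
Proof. by apply: val_inj; rewrite /= ract1. Qed.
Fact AdA_ractM x a b : AdA_ract x (a * b) = AdA_ract (AdA_ract x a) b.
Proof. by apply: val_inj; rewrite /= ractM. Qed.
Fact AdA_ractZ a x b : AdA_ract (a *: x) b = a *: AdA_ract x b.
Proof. by apply: val_inj; rewrite /= ractZ. Qed.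
Fact AdA_ractk (c : k) x : AdA_ract x c%:A = c%:A *: x.
Proof. by apply: val_inj; rewrite /= ractk. Qed.
HB.instance Definition _ := Lmodule_isBimodule.Build k A AdA
  AdA_ractDl AdA_ractDr AdA_ract1 AdA_ractM AdA_ractZ AdA_ractk.

Fact AdA_incl_lin : linear AdA_val. Proof. by []. Qed.
Definition AdA_incl : bimodHom AdA M :=
  @BimodHom k A AdA M AdA_val AdA_incl_lin (fun _ _ => erefl).

Fact AdA_d_subproof a : in_AdA d (d a).
Proof. by exists [:: (1, a)]; rewrite big_seq1 scale1r. Qed.
Definition AdA_d_fun a := mk_AdA (AdA_d_subproof a).
Fact AdA_dL : klinear AdA_d_fun.
Proof. by move=> c a b; apply: val_inj; rewrite /= derL. Qed.
Fact AdA_dM a b :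
  AdA_d_fun (a * b) = ract (AdA_d_fun a) b + a *: AdA_d_fun b.
Proof. by apply: val_inj; rewrite /= derM. Qed.
Definition AdA_d : derivation AdA := Derivation AdA_dL AdA_dM.

Fact AdA_gen w : in_AdA AdA_d w.
Proof.
have [s ws] := AdAP w; exists s; apply: val_inj; rewrite /= ws.
by elim: {w ws} s => [|p s IH]; rewrite ?big_nil // !big_cons IH.
Qed.
Definition AdA_fodc : fodc := Fodc AdA_gen.
End Generated.

Section LeftDualCalculus.
Variable X : fovc.

Fact ldual_d_subproof a : scalar (fun x : X => lie x a).
Proof.
by move=> b x y; have := lie_lin 1 (b *: x) y a; rewrite !scale1r lie_lact => <-.
Qed.
Definition ldual_d_fun a : ldual X := mk_ldual (ldual_d_subproof a).
Fact ldual_dL : klinear ldual_d_fun.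
Proof.
move=> c a b; apply: ldual_eq => x.
by rewrite ?ldualD /= lie_end ractk lie_lact mulr_algl.
Qed.
Fact ldual_dM a b :
  ldual_d_fun (a * b) = ract (ldual_d_fun a) b + a *: ldual_d_fun b.
Proof. by apply: ldual_eq => x; rewrite ?ldualD /= lieM. Qed.
Definition ldual_d : derivation (ldual X) := Derivation ldual_dL ldual_dM.

(* The pair (ldual X, ldual_d) satisfies every axiom of a FODC except, in
   general, the surjectivity of a (x) b |-> a d(b): see
   [ldual_d_not_generating] below. The FODC dual to X is therefore carried by
   the sub-bimodule A dA of ldual X, which is all of ldual X exactly when
   (ldual X, ldual_d) is a FODC. *)
Definition fovc_dual : fodc := AdA_fodc ldual_d.
Definition fovc_dual_incl : bimodHom fovc_dual (ldual X) := AdA_incl ldual_d.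
End LeftDualCalculus.

Section LeftDualCalculusMap.
Variables (X Y : fovc) (f : fovcHom X Y).

Fact ldual_map_d a : ldual_map f (ldual_d Y a) = ldual_d X a.
Proof. by apply: ldual_eq => x /=; rewrite fovcHomP. Qed.

Fact fovc_dual_map_subproof (w : fovc_dual Y) :
  in_AdA (ldual_d X) (ldual_map f (fovc_dual_incl Y w)).
Proof.
have [s ws] := AdAP w; exists s.
rewrite -[fovc_dual_incl Y w]/(AdA_val w) {}ws.
elim: s => [|p s IH]; first by rewrite !big_nil; apply: ldual_eq.
rewrite !big_cons -IH -ldual_map_d -bimodHomZ.
exact: (bimodHomD (ldual_map f)).
Qed.
Definition fovc_dual_map_fun (w : fovc_dual Y) : fovc_dual X :=
  mk_AdA (fovc_dual_map_subproof w).
Fact fovc_dual_map_lin : linear fovc_dual_map_fun.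
Proof.
by move=> a x y; apply: val_inj => /=; rewrite -(bimodHom_lin (ldual_map f)).
Qed.
Fact fovc_dual_map_ract w a :
  fovc_dual_map_fun (ract w a) = ract (fovc_dual_map_fun w) a.
Proof. by apply: val_inj; apply: (bimodHom_ract (ldual_map f)). Qed.
Fact fovc_dual_map_d a :
  fodc_d (fovc_dual X) a = fovc_dual_map_fun (fodc_d (fovc_dual Y) a).
Proof. by apply: val_inj; rewrite /= -[LHS]ldual_map_d. Qed.
Definition fovc_dual_map : fodcHom (fovc_dual Y) (fovc_dual X) :=
  @FodcHom (fovc_dual Y) (fovc_dual X)
    (BimodHom fovc_dual_map_lin fovc_dual_map_ract) fovc_dual_map_d.
End LeftDualCalculusMap.

Fact fovc_dual_map1 X : fovc_dual_map (fovc_id X) = fodc_id (fovc_dual X).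
Proof. by apply: fodcHom_eq => w; apply: val_inj; apply: ldual_eq. Qed.
Fact fovc_dual_mapM X Y Z (g : fovcHom Y Z) (f : fovcHom X Y) :
  fovc_dual_map (fovc_comp g f) = fodc_comp (fovc_dual_map f) (fovc_dual_map g).
Proof. by apply: fodcHom_eq => w; apply: val_inj; apply: ldual_eq. Qed.

Definition fovc_dualF : functor (opc fovcC) fodcC :=
  @Functor (opc fovcC) fodcC fovc_dual (fun Y X f => @fovc_dual_map X Y f)
    fovc_dual_map1 (fun _ _ _ g f => fovc_dual_mapM f g).

Fact fovc_dual_incl_natural X Y (f : fovcHom X Y) :
  bimod_comp (ldual_map f) (fovc_dual_incl Y) =
  bimod_comp (fovc_dual_incl X) (fovc_dual_map f).
Proof. exact: bimodHom_eq. Qed.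
Definition fovc_dual_inclN :
    nat_trans (compF forget_d fovc_dualF) (compF (ldualF A) (opF forget_lie)) :=
  @NatTrans (opc fovcC) (bimodC A) (compF forget_d fovc_dualF)
    (compF (ldualF A) (opF forget_lie)) fovc_dual_incl
    (fun Y X f => @fovc_dual_incl_natural X Y f).

End Calculi.

(* For A = k[x] and the free FOVC of rank one spanned by x d/dx, every element
   of A dA in the dual takes values in (x), while the dual basis does not. *)
Section NotGenerating.
Variable k : fieldType.
Let A : algType k := {poly k}.

Definition polyB : Type := A^o.
HB.instance Definition _ := GRing.Lmodule.on polyB.
Fact polyB_ractk (c : k) (x : polyB) : x * c%:A = c%:A *: x.
Proof. by rewrite mulrC. Qed.
HB.instance Definition _ := Lmodule_isBimodule.Build k A polyB
  (fun x y a => mulrDl x y a) (fun x a b => mulrDr x a b) (@mulr1 A)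
  (@mulrA A) (fun a x b => esym (mulrA a x b)) polyB_ractk.

Definition poly_lie (f : polyB) (g : A) : A := f * 'X * g^`().
Fact poly_lie_end f : linear (poly_lie f).
Proof. by move=> c a b; rewrite /poly_lie linearP mulrDr scalerAr. Qed.
Fact poly_lie_lin (c : k) f g a :
  poly_lie (c%:A *: f + g) a = c *: poly_lie f a + poly_lie g a.
Proof.
rewrite /poly_lie -[c%:A *: f]/((c%:A : A) * f) !mulrDl.
by rewrite -[c *: (_ * _ * _ : A)](mulr_algl c) !mulrA.
Qed.
Fact poly_lie_lact a f b : poly_lie (a *: f) b = a * poly_lie f b.
Proof. by rewrite /poly_lie -!mulrA. Qed.
Fact poly_lieM f a b :
  poly_lie f (a * b) = poly_lie f a * b + poly_lie (ract f a) b.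
Proof.
by rewrite /poly_lie derivM mulrDr !mulrA -[ract f a]/(f * a) (mulrAC f a).
Qed.
Fact poly_lie_inj : injective poly_lie.
Proof.
move=> f g /(congr1 (@^~ 'X)); rewrite /poly_lie derivX !mulr1.
by apply: mulIf; rewrite polyX_eq0.
Qed.
Definition poly_fovc : fovc A :=
  @Fovc k A polyB poly_lie poly_lie_end poly_lie_lin poly_lie_inj
    poly_lie_lact poly_lieM.
Fact poly_id_scalar : scalar (id : poly_fovc -> A).
Proof. by []. Qed.

Lemma ldual_d_not_generating :
  ~ forall w : ldual poly_fovc, in_AdA (ldual_d poly_fovc) w.
Proof.
pose u : poly_fovc := (1 : {poly k}).
pose ev (w : ldual poly_fovc) : k := (w u : {poly k}).[0].
move=> /(_ (mk_ldual poly_id_scalar))[s] /(congr1 ev).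
suff -> : ev (\sum_(p <- s) p.1 *: ldual_d poly_fovc p.2) = 0.
  by move/eqP; rewrite /ev /= hornerC oner_eq0.
elim: s => [|p s IH]; first by rewrite big_nil /ev horner0.
have evD v w : ev (v + w) = ev v + ev w by rewrite /ev ldualD hornerD.
rewrite big_cons evD IH addr0 /ev ldualZ /=.
by rewrite /poly_lie hornerM hornerMX mulr0 mul0r.
Qed.
End NotGenerating.

(* Main.v *)
Require Import Defs.
From mathcomp Require Import all_boot all_algebra.
From mathcomp Require Import boolp.
Local Open Scope ring_scope.
Local Open Scope cat_scope.

(** On bimodules the unit and the counit are evaluation maps: [m] in [M] becomes
    the functional [phi |-> phi m] on a dual of [M].  Both triangle identities
    come down to the fact that evaluating the functional attached to [m] at
    [phi] gives [phi m] ([bimod_adjunction]).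

    On calculi the FODC dual to a FOVC [X] is only the sub-bimodule A dA of the
    left dual of [X].  Passing to it does not change the maps received from
    FODCs: a FODC is generated by its differentials, so a bimodule map out of it
    which commutes with the derivations lands in A dA ([in_AdA_bimodHom]) and
    factors through it ([fodc_lift]).  The unit at a FODC [G] is the
    factorization of evaluation, which commutes with the derivations because
    the Lie derivative on the right dual of [G] is X(da), and d on the left
    dual of that is defined by (da)(X) = X(da).  The counit at a FOVC [X] sends
    [x] to evaluation at [x], restricted from the whole left dual to A dA; it
    preserves Lie derivatives because (da)(x) is by definition that of [a]
    along [x].  Since A dA includes injectively into the dual, naturality, the
    triangle identities and the compatibility with the forgetful functors are
    then pointwise equalities inherited from bimodules. *)

Set Implicit Arguments.
Unset Strict Implicit.
Unset Printing Implicit Defensive.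

Import GRing.Theory.

Section Evaluation.
Variables (k : fieldType) (A : algType k).
Implicit Types M N : bimodType A.

Fact eval_rdual_scalar M (m : M) : scalar (fun phi : rdual M => phi m).
Proof. by []. Qed.
Definition eval_rdual_fun M (m : M) : ldual (rdual M) :=
  mk_ldual (eval_rdual_scalar m).

Fact eval_rdual_lin M : linear (@eval_rdual_fun M).
Proof.
move=> a x y; apply: ldual_eq => phi.
by rewrite ldualD ldualZ /=; case: (rdualP phi) => ->.
Qed.

Fact eval_rdual_ract M (x : M) a :
  eval_rdual_fun (ract x a) = ract (eval_rdual_fun x) a.
Proof. by apply: ldual_eq => phi /=; case: (rdualP phi) => _ ->. Qed.

Definition eval_rdual M : bimodHom M (ldual (rdual M)) :=
  BimodHom (@eval_rdual_lin M) (@eval_rdual_ract M).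

Fact eval_ldual_right_linear M (m : M) :
  right_linear (fun psi : ldual M => psi m).
Proof. by []. Qed.
Definition eval_ldual_fun M (m : M) : rdual (ldual M) :=
  mk_rdual (eval_ldual_right_linear m).

Fact eval_ldual_lin M : linear (@eval_ldual_fun M).
Proof.
by move=> a x y; apply: rdual_eq => psi; rewrite rdualD /= ldualP.
Qed.

Fact eval_ldual_ract M (x : M) a :
  eval_ldual_fun (ract x a) = ract (eval_ldual_fun x) a.
Proof. by apply: rdual_eq. Qed.

Definition eval_ldual M : bimodHom M (rdual (ldual M)) :=
  BimodHom (@eval_ldual_lin M) (@eval_ldual_ract M).

Fact eval_rdual_natural M N (f : bimodHom M N) :
  bimod_comp (ldual_map (rdual_map f)) (eval_rdual M) =
  bimod_comp (eval_rdual N) f.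
Proof. by apply: bimodHom_eq => m; apply: ldual_eq. Qed.

Fact eval_ldual_natural M N (f : bimodHom M N) :
  bimod_comp (rdual_map (ldual_map f)) (eval_ldual M) =
  bimod_comp (eval_ldual N) f.
Proof. by apply: bimodHom_eq => m; apply: rdual_eq. Qed.

Definition bimod_unit : nat_trans (idF (bimodC A)) (ldualF A \oF rdualF A) :=
  @NatTrans (bimodC A) (bimodC A) (idF (bimodC A)) (ldualF A \oF rdualF A)
    eval_rdual eval_rdual_natural.

Definition bimod_counit :
    nat_trans (rdualF A \oF ldualF A) (idF (opc (bimodC A))) :=
  @NatTrans (opc (bimodC A)) (opc (bimodC A)) (rdualF A \oF ldualF A)
    (idF (opc (bimodC A))) eval_ldual
    (fun M N f => esym (@eval_ldual_natural N M f)).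

Lemma bimod_adjunction : is_adjunction bimod_unit bimod_counit.
Proof.
by split=> M; apply: bimodHom_eq => x; [apply: rdual_eq | apply: ldual_eq].
Qed.

End Evaluation.

Section Generated.
Variables (k : fieldType) (A : algType k).
Implicit Types M N : bimodType A.

(** The same list of pairs witnesses both memberships, because [f] is left
    linear and intertwines the two maps. *)
Lemma in_AdA_bimodHom M N (d : A -> M) (d' : A -> N) (f : bimodHom M N) :
  (forall a, d' a = f (d a)) -> forall w, in_AdA d w -> in_AdA d' (f w).
Proof.
move=> fd w [s ->]; exists s.
have f0 : f 0 = 0 by apply: (addrI (f 0)); rewrite -bimodHomD !addr0.
rewrite (big_morph f (bimodHomD f) f0).
by apply: eq_bigr => p _; rewrite bimodHomZ fd.
Qed.

Lemma AdA_incl_inj M (d : derivation M) : injective (AdA_incl d).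
Proof. by move=> x y; apply: val_inj. Qed.

Section Lift.
Variables (M N : bimodType A) (d : derivation M) (f : bimodHom N M).
Hypothesis f_AdA : forall x, in_AdA d (f x).

Definition AdA_lift_fun x : AdA d := mk_AdA (f_AdA x).
Fact AdA_lift_lin : linear AdA_lift_fun.
Proof. by move=> a x y; apply: val_inj; apply: (bimodHom_lin f). Qed.
Fact AdA_lift_ract x a : AdA_lift_fun (ract x a) = ract (AdA_lift_fun x) a.
Proof. by apply: val_inj; apply: (bimodHom_ract f). Qed.
Definition AdA_lift : bimodHom N (AdA d) := BimodHom AdA_lift_lin AdA_lift_ract.

End Lift.

Section FodcLift.
Variables (M : bimodType A) (d : derivation M) (G : fodc A) (f : bimodHom G M).
Hypothesis fd : forall a, d a = f (fodc_d G a).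

Fact fodc_lift_AdA w : in_AdA d (f w).
Proof. exact: in_AdA_bimodHom fd w (fodc_gen w). Qed.
Fact fodc_lift_d a :
  fodc_d (AdA_fodc d) a = AdA_lift fodc_lift_AdA (fodc_d G a).
Proof. by apply: val_inj; apply: fd. Qed.

(** This is the universal property that makes [AdA_fodc d] the coreflection of
    [(M, d)] into FODCs. *)
Definition fodc_lift : fodcHom G (AdA_fodc d) :=
  @FodcHom k A G (AdA_fodc d) (AdA_lift fodc_lift_AdA) fodc_lift_d.

End FodcLift.

(** If A dA is the whole dual, then the identity of the dual lifts to A dA and
    inverts the inclusion. *)
Lemma fovc_dual_incl_iso (X : fovc A) :
  (forall w, in_AdA (ldual_d X) w) -> is_iso (fovc_dual_inclN A X).
Proof.
move=> gen; exists (AdA_lift (f := bimod_id (ldual X)) gen).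
  by apply: bimodHom_eq => w; apply: val_inj.
exact: bimodHom_eq.
Qed.

End Generated.

Section Calculi.
Variables (k : fieldType) (A : algType k).
Implicit Types (G H : fodc A) (X Y : fovc A).

Fact eval_rdual_d G a :
  ldual_d (fodc_dual G) a = eval_rdual G (fodc_d G a).
Proof. exact: ldual_eq. Qed.

Definition eval_fodc G : fodcHom G (fovc_dual (fodc_dual G)) :=
  fodc_lift (@eval_rdual_d G).

Fact eval_fovc_lie X (x : X) :
  lie (bimod_comp (rdual_map (fovc_dual_incl X)) (eval_ldual X) x
        : fodc_dual (fovc_dual X)) = lie x.
Proof. by []. Qed.

Definition eval_fovc X : fovcHom X (fodc_dual (fovc_dual X)) :=
  @FovcHom k A X (fodc_dual (fovc_dual X)) _ (@eval_fovc_lie X).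

Fact eval_fodc_natural G H (f : fodcHom G H) :
  fodc_comp (fovc_dual_map (fodc_dual_map f)) (eval_fodc G) =
  fodc_comp (eval_fodc H) f.
Proof. by apply: fodcHom_eq => w; apply: val_inj; apply: ldual_eq. Qed.

Fact eval_fovc_natural X Y (f : fovcHom X Y) :
  fovc_comp (fodc_dual_map (fovc_dual_map f)) (eval_fovc X) =
  fovc_comp (eval_fovc Y) f.
Proof. by apply: fovcHom_eq => x; apply: rdual_eq. Qed.

Definition calculus_unit :
    nat_trans (idF (fodcC A)) (fovc_dualF A \oF fodc_dualF A) :=
  @NatTrans (fodcC A) (fodcC A) (idF (fodcC A)) (fovc_dualF A \oF fodc_dualF A)
    eval_fodc eval_fodc_natural.

Definition calculus_counit :
    nat_trans (fodc_dualF A \oF fovc_dualF A) (idF (opc (fovcC A))) :=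
  @NatTrans (opc (fovcC A)) (opc (fovcC A)) (fodc_dualF A \oF fovc_dualF A)
    (idF (opc (fovcC A))) eval_fovc
    (fun X Y f => esym (@eval_fovc_natural Y X f)).

Lemma calculus_adjunction : is_adjunction calculus_unit calculus_counit.
Proof.
split=> [G|X]; first by apply: fovcHom_eq => x; apply: rdual_eq.
by apply: fodcHom_eq => w; apply: val_inj; apply: ldual_eq.
Qed.

(** The object and morphism parts agree by computation; only the proofs of
    functoriality differ. *)
Lemma forget_fodc_dualF :
  opF (forget_lie A) \oF fodc_dualF A = rdualF A \oF forget_d A.
Proof. by congr Functor; apply: Prop_irrelevance. Qed.

End Calculi.


Theorem proposition2p10 (k : fieldType) (A : algType k) :
  exists (eta0 : nat_trans (idF (bimodC A)) (ldualF A \oF rdualF A))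
         (eps0 : nat_trans (rdualF A \oF ldualF A) (idF (opc (bimodC A))))
         (eta : nat_trans (idF (fodcC A)) (fovc_dualF A \oF fodc_dualF A))
         (eps : nat_trans (fodc_dualF A \oF fovc_dualF A) (idF (opc (fovcC A)))),
    [/\ (* the adjunction on bimodules, given by evaluation *)
        [/\ is_adjunction eta0 eps0,
            forall (M : bimodType A) (m : M) (phi : rdual M),
              (eta0 M : bimodHom M (ldual (rdual M))) m phi = phi m
          & forall (M : bimodType A) (m : M) (psi : ldual M),
              (eps0 M : bimodHom M (rdual (ldual M))) m psi = psi m],
        (* the adjunction on calculi *)
        is_adjunction eta eps,
        (* both functors on calculi lie over the functors on bimodules *)
        opF (forget_lie A) \oF fodc_dualF A = rdualF A \oF forget_d A,
        [/\ forall X : fovc A, injective (fovc_dual_inclN A X : bimodHom _ _),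
            forall (G : fodc A) (X : fovc A) (Psi : bimodHom G (ldual X)),
              (forall a, ldual_d X a = Psi (fodc_d G a)) ->
              exists Theta : fodcHom G (fovc_dual X),
                forall w, fovc_dual_incl X (Theta w) = Psi w
          & forall X : fovc A, (forall w, in_AdA (ldual_d X) w) ->
              is_iso (fovc_dual_inclN A X)]
      & (* units and counits lie over units and counits *)
        (forall G : fodc A,
           fovc_dual_inclN A (fodc_dual G) \oc fmap (forget_d A) (eta G) =
           eta0 (G : bimodType A)) /\
        (forall X : fovc A,
           fmap (opF (forget_lie A)) (eps X) =
           eps0 (X : bimodType A) \oc fmap (rdualF A) (fovc_dual_inclN A X))].
Proof.
exists (bimod_unit A), (bimod_counit A), (calculus_unit A), (calculus_counit A).
split.
- by split=> //; apply: bimod_adjunction.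
- exact: calculus_adjunction.
- exact: forget_fodc_dualF.
- split=> [X|G X Psi Psid|X]; first exact: AdA_incl_inj.
    by exists (fodc_lift Psid).
  exact: fovc_dual_incl_iso.
- by split=> [G|X]; apply: bimodHom_eq.
Qed.
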